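(* There exist $\theta_0>0$ and $\kappa_0<\infty$ such that for every integer $n\ge 1$ there exists a coupling of $S_n$ with a standard Gaussian random variable $Z\sim N(0,1)$ such that $$\mathbf{E}\left[e^{\theta_0|S_n-Z\sqrt{n}|}\right]\le \kappa_0.$$
   Context: $S_n=X_1+\ldots+X_n$ where $X_1,X_2,\ldots$ are i.i.d. symmetric Bernoulli random variables, i.e., $X_i=\pm1$ with probability $1/2$ each. A coupling of random variables $X,Y$ satisfying certain statements means a probability space carrying random variables with the same marginal distributions as $X$ and $Y$ respectively and satisfying the stated mutual relationships. *)

(* Defs.v *)
From HB Require Import structures.
From mathcomp Require Import all_boot all_order all_algebra.
From mathcomp Require Import all_classical all_reals all_analysis.
From mathcomp Require Import measurable_realfun.

Set Implicit Arguments.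
Unset Strict Implicit.
Unset Printing Implicit Defensive.

Import Order.TTheory GRing.Theory Num.Theory.
Import numFieldNormedType.Exports.

Local Open Scope classical_set_scope.
Local Open Scope ring_scope.

Section defs.
Context (R : realType).

Section on_a_space.
Context (d : measure_display) (T : measurableType d) (P : probability T R).

(* Mutual independence: the product rule over every finite subfamily, listed
   without repetition by J. *)
Definition mutually_independent (X : nat -> {RV P >-> R}) : Prop :=
  forall (J : seq nat) (A : nat -> set R),
    uniq J -> (forall i, measurable (A i)) ->
    P (\bigcap_(i in [set` J]) X i @^-1` A i) =
    (\prod_(i <- J) P (X i @^-1` A i))%E.

Definition symmetric_bernoulli (X : {RV P >-> R}) : Prop :=
  P (X @^-1` [set 1]) = (2^-1)%:E /\ P (X @^-1` [set -1]) = (2^-1)%:E.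

Definition iid_symmetric_bernoulli (X : nat -> {RV P >-> R}) : Prop :=
  mutually_independent X /\ forall i, symmetric_bernoulli (X i).

(* S_n = X_1 + ... + X_n, with X_1, X_2, ... indexed from 0. *)
Definition walk (X : nat -> {RV P >-> R}) (n : nat) : {RV P >-> R} :=
  \sum_(i < n) (X i : {mfun T >-> R}).

(* Laws are compared on measurable sets only: a set function such as
   normal_prob is also defined, but carries no meaning, on the other sets. *)
Definition has_law (X : {RV P >-> R}) (mu : set R -> \bar R) : Prop :=
  forall A : set R, measurable A -> distribution P X A = mu A.

(* The random variables X, Y on (T, P) realize a coupling of mu and nu. *)
Definition coupling (mu nu : set R -> \bar R) (X Y : {RV P >-> R}) : Prop :=
  has_law X mu /\ has_law Y nu.

End on_a_space.
End defs.

(* Main.v *)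
(* Quantile coupling in the manner of Tusnady. On the real line with its standard
   normal law let Z be the identity and S the nondecreasing step function with the
   law of S_n. With s = sqrt n, it is enough to show |S - s Z| <= 210 + 8 Z^2, since
   E exp (3/8 Z^2) = 2. That bound amounts to the tail comparison
     P (s Z >= k + 8 + 4 k^2 / n) <= P (S_n >= k) <= P (s Z >= k - 3)
   for the values k >= 0, resp. k >= 1, of the walk, the negative ones being
   symmetric. The differences of the two tails are nonnegative at both ends of the
   range of k and, since the ratios of consecutive masses are ordered, once such a
   difference decreases it goes on decreasing; so it is nonnegative throughout. In
   this way only the ratios (n - k) / (n + k + 2) of binomial weights are needed,
   and no Stirling formula. *)

Require Import Defs.
From HB Require Import structures.
From mathcomp Require Import all_boot all_order all_algebra.
From mathcomp Require Import all_classical all_reals all_analysis.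
From mathcomp Require Import measurable_realfun.
From mathcomp Require Import zify ring lra.

Set Implicit Arguments.
Unset Strict Implicit.
Unset Printing Implicit Defensive.

Import Order.TTheory GRing.Theory Num.Theory.
Import numFieldNormedType.Exports.

Local Open Scope classical_set_scope.
Local Open Scope ring_scope.

(** * The Gaussian tail and an exponential moment *)

Section gaussian_tail.
Context {R : realType}.
Notation mu := (@lebesgue_measure R).

Definition gtail (x : R) : R := fine (normal_prob 0 1 `]x, +oo[).

Lemma normal_pdf01E (x : R) :
  normal_pdf 0 1 x = normal_peak 1 * expR (- x ^+ 2 / 2).
Proof. by rewrite normal_pdfE ?oner_neq0// /normal_fun subr0 expr1n. Qed.

Lemma normal_pdf01_gt0 (x : R) : 0 < normal_pdf 0 1 x.
Proof. by rewrite normal_pdf01E mulr_gt0 ?expR_gt0// normal_peak_gt0// oner_neq0. Qed.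

Lemma normal_prob_gtail (x : R) : normal_prob 0 1 `]x, +oo[ = (gtail x)%:E.
Proof. by rewrite fineK// fin_num_measure. Qed.

Lemma gtailE (x : R) :
  gtail x = 1 - (\int[mu]_(t in `]-oo, x]) normal_pdf 0 1 t)%R.
Proof.
apply: EFin_inj; rewrite -normal_prob_gtail EFinB.
have -> : ((\int[mu]_(t in `]-oo, x]) normal_pdf 0 1 t)%R)%:E =
    normal_prob 0 1 `]-oo, x].
  by rewrite -[RHS]fineK// fin_num_measure.
by rewrite -probability_setC// setCitvl.
Qed.

Lemma is_derive_gtail (x : R) : is_derive x 1 gtail (- normal_pdf 0 1 x).
Proof.
have -> : gtail = (fun x => 1 - (\int[mu]_(t in `]-oo, x]) normal_pdf 0 1 t)%R).
  by apply/funext => y; exact: gtailE.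
have [] := @continuous_FTC1 R (normal_pdf 0 1) -oo%O x (x + 1).
- by rewrite ltrDl.
- by apply: (integrableS _ _ (subsetT _)) => //; exact: integrable_normal_pdf.
- by rewrite ltNyr.
- exact/continuous_normal_pdf/oner_neq0.
move=> dF F'; rewrite -[X in is_derive _ _ _ X]sub0r.
apply: is_deriveB; split => //; by rewrite -derive1E.
Qed.

Lemma continuous_gtail : continuous gtail.
Proof.
move=> x; apply/differentiable_continuous/derivable1_diffP.
exact: (@ex_derive _ _ _ _ _ _ _ (is_derive_gtail x)).
Qed.

Lemma gtail_decr (x y : R) : x < y -> gtail y < gtail x.
Proof.
move=> xy; have [||c _ Hc] := @MVT R gtail (fun t => - normal_pdf 0 1 t) x y xy.
- by move=> *; exact: is_derive_gtail.
- exact/continuous_subspaceT/continuous_gtail.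
by rewrite -subr_lt0 Hc mulNr oppr_lt0 mulr_gt0 ?normal_pdf01_gt0// subr_gt0.
Qed.

Lemma gtail_le_mono : {mono gtail : x y /~ x <= y}.
Proof. by apply: le_nmono => x y; exact: gtail_decr. Qed.

Lemma gtailN (x : R) : gtail (- x) = 1 - gtail x.
Proof.
rewrite [in LHS]gtailE; congr (1 - fine _).
rewrite ge0_integration_by_substitutionNy; last first.
- by move=> y _; exact: normal_pdf_ge0.
- exact/continuous_subspaceT/continuous_normal_pdf/oner_neq0.
rewrite -integral_itv_obnd_cbnd /normal_prob; last first.
  apply/measurable_EFinP/measurable_funTS/measurableT_comp => //.
  exact: measurable_normal_pdf.
by apply: eq_integral => y _; rewrite /= !normal_pdf01E sqrrN.
Qed.

Lemma gtail0 : gtail 0 = 2^-1.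
Proof. by have := gtailN 0; rewrite oppr0; lra. Qed.

(** For [y > x >= 0] the density at [y] is at most [expR (- x ^+ 2 / 2)] times that at [y - x],
    because [x * (y - x) >= 0]. *)
Lemma gtail_le_expR (x : R) : 0 <= x -> gtail x <= expR (- x ^+ 2 / 2).
Proof.
move=> x0; rewrite -lee_fin -normal_prob_gtail.
have /(le_trans _) : ((expR (- x ^+ 2 / 2))%:E * normal_prob x 1 `]x, +oo[ <=
    (expR (- x ^+ 2 / 2))%:E)%E.
  by rewrite -[leRHS]mule1 lee_pmul2l ?lte_fin ?expR_gt0 ?probability_le1.
apply; rewrite /normal_prob -ge0_integralZl//=; last 2 first.
- apply/measurable_EFinP/measurable_funTS; exact: measurable_normal_pdf.
- by move=> y _; rewrite lee_fin normal_pdf_ge0.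
apply: ge0_le_integral => //=.
- by move=> y _; rewrite lee_fin normal_pdf_ge0.
- apply/measurable_EFinP/measurable_funTS; exact: measurable_normal_pdf.
- apply/measurable_EFinP/measurable_funM => //.
  apply/measurable_funTS; exact: measurable_normal_pdf.
move=> y; rewrite in_itv/= andbT => xy; rewrite lee_fin.
rewrite normal_pdf01E normal_pdfE ?oner_neq0// mulrCA /normal_fun -expRD.
rewrite ler_pM2l ?normal_peak_gt0 ?oner_neq0// ler_expR expr1n.
have : 0 <= x * (y - x) by rewrite mulr_ge0// subr_ge0 ltW.
rewrite !expr2; lra.
Qed.

Lemma gtail_surj (q : R) : 0 < q < 1 -> exists x, gtail x = q.
Proof.
move=> /andP[q0 q1].
have small (e : R) : 0 < e -> exists2 x, 0 <= x & gtail x <= e.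
  (* With [x = 1 + e^-1] one has [expR (x ^+ 2 / 2) >= 1 + x ^+ 2 / 2 >= e^-1]. *)
  move=> e0; exists (1 + e^-1); first by rewrite addr_ge0// invr_ge0 ltW.
  have x0 : 0 <= 1 + e^-1 by rewrite addr_ge0// invr_ge0 ltW.
  apply: (le_trans (gtail_le_expR x0)).
  rewrite mulNr expRN invf_ple ?posrE ?expR_gt0//.
  apply: le_trans (expR_ge1Dx _).
  have : 0 < e^-1 by rewrite invr_gt0.
  rewrite expr2; nra.
have [x x0 xq] := small _ q0.
have [|y y0 yq] := small (1 - q); first by rewrite subr_gt0.
have yx : - y <= x by rewrite (le_trans _ x0)// oppr_le0.
have [||c _ <-] := @IVT R gtail (- y) x q yx; last by exists c.
  exact/continuous_subspaceT/continuous_gtail.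
rewrite ge_min le_max gtailN xq orbT/=; apply/orP; left; lra.
Qed.

(* The weighted density is that of the normal law of standard deviation 2. *)
Lemma normal_expR_sqr :
  (\int[normal_prob 0 1]_x (expR (3 / 8 * x ^+ 2))%:E = 2%:E :> \bar R)%E.
Proof.
have mf : measurable_fun [set: R] (fun x : R => expR (3 / 8 * x ^+ 2)).
  apply: measurableT_comp => //; apply: measurable_funM => //.
have dom : (normal_prob 0 1 : {finite_measure set _ -> \bar R}) `<< mu.
  exact: normal_prob_dominates.
rewrite -(Radon_Nikodym_SigmaFinite.change_of_variables dom)//=; last first.
  exact/measurable_EFinP.
transitivity (\int[mu]_x ((expR (3 / 8 * x ^+ 2))%:E * (normal_pdf 0 1 x)%:E))%E.
  apply: ae_eq_integral => //.
  - apply: emeasurable_funM; first exact/measurable_EFinP.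
    apply: (measurable_int mu); exact: Radon_Nikodym_SigmaFinite.f_integrable.
  - apply: emeasurable_funM; first exact/measurable_EFinP.
    by apply/measurable_EFinP; exact: measurable_normal_pdf.
  - apply: ae_eqe_mul2l; apply: integral_ae_eq => //=.
    + exact: Radon_Nikodym_SigmaFinite.f_integrable.
    + by apply/measurable_EFinP; exact: measurable_normal_pdf.
    + by move=> E _ mE; rewrite -Radon_Nikodym_SigmaFinite.f_integral.
have pdf02 (x : R) : expR (3 / 8 * x ^+ 2) * normal_pdf 0 1 x = 2 * normal_pdf 0 2 x.
  rewrite normal_pdf01E normal_pdfE ?pnatr_eq0// /normal_fun mulrCA -expRD.
  rewrite [RHS]mulrA; congr (_ * expR _); last first.
    by rewrite subr0 -mulr_natr; field.
  rewrite /normal_peak expr1n mul1r -mulrnAr sqrtrM ?sqr_ge0// sqrtr_sqr.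
  by rewrite normr_nat invfM mulrA divff ?mul1r// pnatr_eq0.
under eq_integral => x _ do rewrite -EFinM pdf02 EFinM.
rewrite ge0_integralZl//=; last 2 first.
- by apply/measurable_EFinP; exact: measurable_normal_pdf.
- by move=> x _; rewrite lee_fin normal_pdf_ge0.
by rewrite integral_normal_pdf mule1.
Qed.

End gaussian_tail.

(** From [D a >= 0] a negative value is reached only by a descent, which then persists up to [b] and
    contradicts [D b >= 0]. *)
Lemma single_crossing_ge0 {R : realDomainType} (D : nat -> R) (a b : nat) :
  0 <= D a -> 0 <= D b ->
  (forall i, (a <= i)%N -> (i.+1 < b)%N -> D i.+1 <= D i -> D i.+2 <= D i.+1) ->
  forall i, (a <= i <= b)%N -> 0 <= D i.
Proof.
move=> Da Db step.
have desc j : (a + j < b)%N -> D (a + j)%N < 0 -> D (a + j).+1 <= D (a + j)%N.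
  elim: j => [|j IH]; first by rewrite addn0 ltNge Da.
  rewrite addnS => jb Dj; apply: step => //; first exact: leq_addr.
  have [Dj0|/IH] := leP 0 (D (a + j)%N); first exact: le_trans (ltW Dj) Dj0.
  by apply; exact: ltnW.
have neg j : (a + j <= b)%N -> D (a + j)%N < 0 ->
    forall l, (a + j + l <= b)%N -> D (a + j + l)%N < 0.
  move=> jb Dj; elim=> [|l IH]; first by rewrite addn0.
  rewrite addnS => lb; have Dl := IH (ltnW lb).
  by rewrite -addnA in lb Dl *; rewrite (le_lt_trans (desc _ lb Dl)).
move=> i /andP[ai ib]; rewrite leNgt; apply/negP => Di.
have := neg (i - a)%N; rewrite subnKC// => /(_ ib Di (b - i)%N).
by rewrite subnKC// ltNge Db => /(_ (leqnn b)).
Qed.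

(** * Exponential bounds for (1 - u) / (1 + u) *)

Section exp_bounds.
Context {R : realType}.

(** The function [f] below is 1 at 0 and nondecreasing. With [u = (k + 1) / (n + 1)], (1 - u) / (1 +
    u) is the binomial ratio (n - k) / (n + k + 2). *)
Lemma subr1_le_expR (u : R) : 0 <= u -> 1 - u <= (1 + u) * expR (- (2 * u)).
Proof.
rewrite le_eqVlt => /predU1P[<-|u0].
  by rewrite mulr0 oppr0 expR0 mulr1; lra.
pose f (x : R) := (1 + x) * expR (- (2 * x)) + x.
pose df (x : R) := 1 - (1 + 2 * x) * expR (- (2 * x)).
have dfE (x : R) : is_derive x 1 f (df x).
  apply: is_derive_eq; rewrite /df /GRing.scale/=; ring.
have [|c] := @MVT R f df 0 u u0.
  apply/continuous_subspaceT => x.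
  exact/differentiable_continuous/derivable1_diffP/(@ex_derive _ _ _ _ _ _ _ (dfE x)).
rewrite in_itv/= => /andP[c0 _] fE.
suff : 0 <= df c * (u - 0) by rewrite -fE /f mulr0 oppr0 expR0; lra.
rewrite subr0 mulr_ge0 ?(ltW u0)// /df subr_ge0 expRN ler_pdivrMr ?expR_gt0//.
by rewrite mul1r expR_ge1Dx.
Qed.

(** By [expR_ge1Dx] it is enough that (1 - u) (1 + 2 u + 4 u^2) exceeds 1 + u by 2 u^2 (1 - 2 u),
    which is nonnegative up to 1/2. *)
Lemma expR_le_subr1 (u : R) : 0 <= u <= 2^-1 ->
  (1 + u) * expR (- (2 * u + 4 * u ^+ 2)) <= 1 - u.
Proof.
move=> /andP[u0 u1]; rewrite expRN ler_pdivrMr ?expR_gt0//.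
have := expR_ge1Dx (2 * u + 4 * u ^+ 2).
set E := expR _; rewrite expr2; nra.
Qed.

End exp_bounds.

(** * Symmetric binomial masses and tails *)

Section binomial_tail.
Context {R : realType}.
Implicit Types n i j : nat.

Definition bpmf n i : R := 'C(n, i)%:R / 2 ^+ n.

Definition btail n i : R := \sum_(i <= j < n.+1) bpmf n j.

Lemma bpmf_ge0 n i : 0 <= bpmf n i.
Proof. by rewrite divr_ge0// exprn_ge0. Qed.

Lemma bpmfS n i : bpmf n i.+1 = (n - i)%:R / i.+1%:R * bpmf n i.
Proof.
have i0 : (i.+1%:R : R) != 0 by rewrite pnatr_eq0.
apply: (mulfI i0); rewrite /bpmf [LHS]mulrA -natrM mul_bin_left natrM.
by rewrite -!mulrA [RHS]mulrCA mulVKf.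
Qed.

Lemma btailE n i : (i <= n)%N -> btail n i = bpmf n i + btail n i.+1.
Proof. by move=> ?; rewrite /btail big_ltn. Qed.

Lemma btail_gt n i : (n < i)%N -> btail n i = 0.
Proof. by move=> ?; rewrite /btail big_geq. Qed.

Lemma btail0 n : btail n 0 = 1.
Proof.
rewrite /btail -mulr_suml big_mkord -natr_sum.
rewrite (_ : (\sum_(i < n.+1) 'C(n, i) = 2 ^ n)%N).
  by rewrite natrX divff// expf_neq0// pnatr_eq0.
by rewrite -[2%N]/(1 + 1)%N expnDn; apply: eq_bigr => j _; rewrite !exp1n !muln1.
Qed.

Lemma btail_nincr n i j : (i <= j)%N -> btail n j <= btail n i.
Proof.
elim: j => [|j IH]; first by rewrite leqn0 => /eqP->.
rewrite leq_eqVlt => /predU1P[->//|]; rewrite ltnS => /IH; apply: le_trans.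
have [jn|jn] := leqP j n; first by rewrite (btailE jn) lerDr bpmf_ge0.
by rewrite !btail_gt// ltnW.
Qed.

Lemma btail_rev n i : (i <= n.+1)%N -> btail n (n.+1 - i) = 1 - btail n i.
Proof.
elim: i => [|i IH] ile; first by rewrite subn0 btail_gt// btail0 subrr.
rewrite subSS btailE ?leq_subr// -subSn// IH ?(ltnW ile)// (@btailE n i)//.
by rewrite /bpmf bin_sub//; ring.
Qed.

Lemma btail_ge n i : (i <= n)%N -> (2 ^+ n)^-1 <= btail n i.
Proof.
move=> /(btail_nincr n); apply: le_trans.
by rewrite btailE// btail_gt// addr0 /bpmf binn mul1r.
Qed.

Lemma btail_gt0 n i : (i <= n)%N -> 0 < btail n i.
Proof. by move=> /btail_ge; apply: lt_le_trans; rewrite invr_gt0 exprn_gt0. Qed.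

Lemma btail_lt1 n i : (0 < i)%N -> btail n i < 1.
Proof.
move=> i0; apply: le_lt_trans (btail_nincr n i0) _.
by rewrite -(btail0 n) [ltRHS]btailE// ltrDr /bpmf bin0 mul1r invr_gt0 exprn_gt0.
Qed.

End binomial_tail.

(** * Comparison of the binomial and Gaussian tails *)

Section tail_comparison.
Context {R : realType}.

(* Mean value theorem for [r * gtail (T x) - gtail (T (x + 2))]: ratios of masses
   of consecutive cells are ratios of densities. *)
Lemma gtail_comp_step (T T' : R -> R) (r k : R) :
  (forall x, is_derive (x : R) 1 T (T' x)) ->
  exists2 c, k < c < k + 2 &
    gtail (T (k + 2)) - gtail (T (k + 4)) -
      r * (gtail (T k) - gtail (T (k + 2))) =
    2 * (T' (c + 2) * normal_pdf 0 1 (T (c + 2)) -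
         r * (T' c * normal_pdf 0 1 (T c))).
Proof.
move=> dT.
pose W (x : R) := r * gtail (T x) - gtail (T (x + 2)).
pose W' (x : R) := T' (x + 2) * normal_pdf 0 1 (T (x + 2)) -
         r * (T' x * normal_pdf 0 1 (T x)).
have dG (x : R) : is_derive x 1 (fun x => gtail (T x)) (- (T' x * normal_pdf 0 1 (T x))).
  rewrite -mulNr mulrC mulrN -mulNr; exact: (is_derive1_comp (is_derive_gtail _) (dT x)).
have dS (x : R) : is_derive x 1 (fun x : R => x + 2) 1.
  by apply: is_derive_eq; rewrite addr0.
have dW (x : R) : is_derive x 1 W (W' x).
  have d2 := @is_derive1_comp R (gtail \o T) (fun x => x + 2) x _ _ (dG _) (dS x).
  apply: (is_derive_eq (is_deriveB (is_deriveZ r (dG x)) d2)).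
  by rewrite /W' /GRing.scale/=; ring.
have k2 : k < k + 2 by lra.
have [|c ck WE] := @MVT R W W' k (k + 2) k2.
  apply/continuous_subspaceT => x.
  exact/differentiable_continuous/derivable1_diffP/(@ex_derive _ _ _ _ _ _ _ (dW x)).
exists c; first by move: ck; rewrite in_itv.
move: WE; rewrite /W /W' (_ : k + 2 + 2 = k + 4); lra.
Qed.

(** The exponents met in [gtail_le_btail], with [m = 1 / n]: [16 * m] pays for the growth of the
    derivative of the shifted argument, [2 * u + 4 * u ^+ 2] for the binomial ratio. *)
Lemma exponent_step (c m u : R) : 0 <= c -> 0 <= m -> 0 <= u -> u <= (c + 1) * m ->
  16 * m + - ((c + 2 + 8 + 4 * (c + 2) ^+ 2 * m) ^+ 2 * m) / 2 <=
  - (2 * u + 4 * u ^+ 2) + - ((c + 8 + 4 * c ^+ 2 * m) ^+ 2 * m) / 2.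
Proof.
move=> c0 m0 u0 um; have uu : u ^+ 2 <= ((c + 1) * m) ^+ 2.
  by rewrite ler_sqr// nnegrE (le_trans u0).
rewrite -subr_ge0 in uu; rewrite -subr_ge0 in um; rewrite -subr_ge0.
(* In terms of the midpoint of [c] and [c + 2], every summand of the difference is nonnegative. *)
pose y := c + 1.
rewrite (_ : _ - _ = 2 * (y * m - u) + 4 * ((y * m) ^+ 2 - u ^+ 2) +
  (20 * (y * m) ^+ 2 + 8 * m ^+ 2 +
   8 * (y * m) * m * (16 + 8 * m * y ^+ 2 + 8 * m))); last by rewrite /y; field.
have y0 : 0 <= y by rewrite /y; lra.
by rewrite !addr_ge0 ?mulr_ge0 ?exprn_ge0 ?mulr_ge0// ?addr_ge0 ?mulr_ge0 ?exprn_ge0.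
Qed.

Variable n : nat.
Hypothesis n0 : (0 < n)%N.
Let s := Num.sqrt (n%:R : R).

Let s0 : 0 < s. Proof. by rewrite sqrtr_gt0 ltr0n. Qed.
Let ss : s ^+ 2 = n%:R. Proof. by rewrite sqr_sqrtr// ler0n. Qed.

(* The value of the walk after [n] steps, [i] of which are upward. *)
Definition wval (i : nat) : R := 2 * i%:R - n%:R.

Lemma wvalS i : wval i.+1 = wval i + 2.
Proof. by rewrite /wval -natr1; ring. Qed.

Lemma wvalSS i : wval i.+2 = wval i + 4.
Proof. by rewrite !wvalS; ring. Qed.

Lemma wval_ratio i : (i <= n)%N ->
  (n - i)%:R / i.+1%:R = (n%:R - wval i) / (n%:R + wval i + 2) :> R.
Proof.
move=> ile; rewrite natrB// /wval -natr1.
have i0 : 0 <= i%:R :> R by [].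
by field; apply/andP; split; apply/lt0r_neq0; lra.
Qed.

(** Single crossing from the first positive value of the walk up to index [n.+1], where the binomial
    tail vanishes. *)
Lemma btail_le_gtail i : (n < i.*2)%N -> (i <= n.+1)%N ->
  btail n i <= gtail ((wval i - 3) / s).
Proof.
move=> ni ile; rewrite -subr_ge0.
have nR0 : 0 < n%:R :> R by rewrite ltr0n.
pose D i := gtail ((wval i - 3) / s) - btail n i.
rewrite -/(D i).
apply: (@single_crossing_ge0 R D n./2.+1 n.+1); last by lia.
(* By symmetry the binomial tail is at most 1/2 here, while [wval] is at most 2, so that the
   Gaussian argument is negative. *)
- rewrite subr_ge0; apply: (@le_trans _ _ 2^-1).
    have := @btail_rev R n n./2.+1; have := @btail_nincr R n (n.+1 - n./2.+1) n./2.+1.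
    by move=> /(_ ltac:(lia)) + /(_ ltac:(lia)); lra.
  rewrite -gtail0 gtail_le_mono pmulr_lle0 ?invr_gt0//.
  have : ((n./2.+1).*2%:R <= n%:R + 2 :> R) by rewrite -natrD ler_nat; lia.
  rewrite /wval -muln2 natrM; lra.
- rewrite /D btail_gt// subr0 fine_ge0//.
move=> j aj jb; rewrite /D (@btailE _ _ j) ?(@btailE _ _ j.+1) ?bpmfS; [|lia..].
rewrite wval_ratio; last lia.
have kj : 1 <= wval j.
  have : (n.+1%:R <= (j.*2)%:R :> R) by rewrite ler_nat; lia.
  rewrite /wval -muln2 natrM -natr1; lra.
have jk : wval j <= n%:R.
  have : (j%:R <= n%:R :> R) by rewrite ler_nat; lia.
  rewrite /wval; lra.
set r := (n%:R - _) / _.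
have dT (x : R) : is_derive x 1 (fun x => (x - 3) / s) s^-1.
  by apply: is_derive_eq; rewrite /GRing.scale/=; ring.
have [c /andP[ck kc]] := gtail_comp_step r (wval j) dT.
rewrite wvalSS wvalS.
move=> E.
have r0 : 0 <= r by rewrite divr_ge0//; lra.
(* A descent of [D] means that the Gaussian mass of this cell is at least the binomial one; a
   Gaussian ratio of at least [r] carries this to the next cell. *)
suff H : r * normal_pdf 0 1 ((c - 3) / s) <= normal_pdf 0 1 ((c + 2 - 3) / s).
  have {}H : 0 <= 2 * (s^-1 * normal_pdf 0 1 ((c + 2 - 3) / s) -
         r * (s^-1 * normal_pdf 0 1 ((c - 3) / s))).
    by rewrite mulr_ge0// mulrCA -mulrBr mulr_ge0 ?invr_ge0 ?(ltW s0)// subr_ge0.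
  rewrite -E in H.
  move: H; set g0 := gtail _; set g1 := gtail _; set g2 := gtail _.
  set p := bpmf n j; set t := btail _ _ => H Hd.
  have : r * p <= r * (g2 - g0) by rewrite ler_wpM2l//; lra.
  lra.
rewrite !normal_pdf01E mulrCA ler_pM2l ?normal_peak_gt0 ?oner_neq0//.
set u := (wval j + 1) / (n%:R + 1).
have u0 : 0 <= u by rewrite divr_ge0//; lra.
have ru : r * (1 + u) = 1 - u.
  by rewrite /r /u; field; apply/andP; split; apply/lt0r_neq0; lra.
have rle : r <= expR (- (2 * u)).
  have := subr1_le_expR u0; rewrite -ru mulrC ler_pM2l//; lra.
apply: le_trans (_ : expR (- (2 * u)) * expR (- ((c - 3) / s) ^+ 2 / 2) <= _).
  by rewrite ler_pM2r ?expR_gt0.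
rewrite -expRD ler_expR !exprMn exprVn ss.
(* With the shift 3 the Gaussian exponents differ by 2 (c - 2) / n, which is at most [2 * u] since
   [c - 2 < wval j]. *)
have : wval j / n%:R <= u.
  by rewrite /u ler_pdivrMr// mulrAC ler_pdivlMr; [nra|lra].
have : (c - 2) / n%:R <= wval j / n%:R by rewrite ler_pM2r ?invr_gt0//; lra.
move: (n%:R^-1) => m; rewrite !expr2; lra.
Qed.

(* The shift [8 + 4 x^2 / n] makes the ratio of consecutive Gaussian masses
   smaller than that of binomial ones as long as [2 x < n], and carries [n / 2]
   past [3 n / 2], where the Gaussian tail is below [2^-n]. *)
Lemma gtail_le_btail i : (n <= i.*2)%N -> (i <= n)%N ->
  gtail ((wval i + 8 + 4 * wval i ^+ 2 / n%:R) / s) <= btail n i.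
Proof.
pose T (x : R) := (x + 8 + 4 * x ^+ 2 / n%:R) / s.
rewrite -/(T (wval i)).
have nR0 : 0 < n%:R :> R by rewrite ltr0n.
have w_ge0 j : (n <= j.*2)%N -> 0 <= wval j.
  move=> nj; have : (n%:R <= (j.*2)%:R :> R) by rewrite ler_nat.
  rewrite /wval -muln2 natrM; lra.
have big j : (3 * n <= 4 * j)%N -> (j <= n)%N -> gtail (T (wval j)) <= btail n j.
  move=> nj jn; apply: le_trans (btail_ge jn).
  have kj : n%:R / 2 <= wval j.
    have : ((3 * n)%:R <= (4 * j)%:R :> R) by rewrite ler_nat.
    rewrite /wval !natrM; lra.
  have Tge : s * (3 / 2) <= T (wval j).
    rewrite /T ler_pdivlMr// mulrAC -expr2 ss.
    have : n%:R <= 4 * wval j ^+ 2 / n%:R.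
      have : 0 <= (2 * wval j - n%:R) * (2 * wval j + n%:R) by rewrite mulr_ge0; lra.
      by rewrite ler_pdivlMr//; lra.
    lra.
  have Tp : 0 <= T (wval j) by apply: le_trans Tge; rewrite mulr_ge0// ltW.
  (* The square of [3 / 2 * s] makes the tail at most exp (- 9 n / 8), hence at most exp (- n), and
     e >= 2. *)
  apply: (le_trans (gtail_le_expR Tp)).
  apply: (@le_trans _ _ (expR (- n%:R))).
    rewrite ler_expR.
    have : (s * (3 / 2)) ^+ 2 <= T (wval j) ^+ 2.
      by rewrite ler_sqr// nnegrE mulr_ge0// ltW.
    rewrite exprMn ss; lra.
  rewrite expRN lef_pV2 ?posrE ?expR_gt0 ?exprn_gt0//.
  rewrite -[n%:R]mul1r expRM_natr lerXn2r// ?nnegrE ?expR_ge0//.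
  have := @expR_ge1Dx R 1; lra.
move=> ni ile; have [/big|lt34] := leqP (3 * n)%N (4 * i)%N; first exact.
rewrite -subr_ge0; pose D i := btail n i - gtail (T (wval i)); rewrite -/(D i).
(* The least index covered by [big]; single crossing handles those from n / 2 up to it. *)
pose b := ((3 * n + 3) %/ 4)%N.
have b1 : (3 * n <= 4 * b)%N by rewrite /b; lia.
have b2 : (4 * b <= 3 * n + 3)%N by rewrite /b; lia.
apply: (@single_crossing_ge0 R D (uphalf n) b); last by lia.
- rewrite subr_ge0; apply: (@le_trans _ _ 2^-1).
    rewrite -gtail0 gtail_le_mono divr_ge0 ?(ltW s0)//.
    have k0 := w_ge0 (uphalf n) ltac:(lia).
    by apply: addr_ge0; [lra|rewrite divr_ge0// mulr_ge0// sqr_ge0].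
  have := @btail_rev R n (uphalf n); have := @btail_nincr R n (uphalf n) (n.+1 - uphalf n).
  by move=> /(_ ltac:(lia)) + /(_ ltac:(lia)); lra.
- by rewrite subr_ge0 big//; lia.
move=> j aj jb; rewrite /D (@btailE _ _ j) ?(@btailE _ _ j.+1) ?bpmfS; [|lia..].
rewrite wval_ratio; last lia.
have kj : 0 <= wval j by apply: w_ge0; lia.
(* Equivalent to [u <= 2^-1] for the [u] below, as [expR_le_subr1] requires. *)
have jk : 2 * wval j + 1 <= n%:R.
  have : ((4 * j + 1)%:R <= (3 * n)%:R :> R) by rewrite ler_nat; lia.
  rewrite /wval natrD !natrM; lra.
set r := (n%:R - _) / _.
pose T' (x : R) := (1 + 8 * x / n%:R) / s.
have dT (x : R) : is_derive (x : R) 1 T (T' x).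
  by apply: is_derive_eq; rewrite /T' /GRing.scale/=; ring.
have [c /andP[ck kc]] := gtail_comp_step r (wval j) dT.
rewrite wvalSS wvalS.
move=> E.
have r0 : 0 <= r by rewrite divr_ge0//; lra.
(* The roles are exchanged: a descent bounds the Gaussian mass by the binomial one, so the Gaussian
   ratio must be at most [r]. *)
suff H : T' (c + 2) * normal_pdf 0 1 (T (c + 2)) <=
    r * (T' c * normal_pdf 0 1 (T c)).
  rewrite -subr_le0 in H.
  have {}H : 2 * (T' (c + 2) * normal_pdf 0 1 (T (c + 2)) -
     r * (T' c * normal_pdf 0 1 (T c))) <= 0 by rewrite pmulr_rle0.
  rewrite -E in H.
  move: H; set g0 := gtail _; set g1 := gtail _; set g2 := gtail _.
  set p := bpmf n j; set t := btail _ _ => H Hd.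
  have : r * (g2 - g0) <= r * p by rewrite ler_wpM2l//; lra.
  lra.
rewrite !normal_pdf01E (mulrCA (T' (c + 2))) (mulrCA (T' c)) (mulrCA r).
rewrite ler_pM2l ?normal_peak_gt0 ?oner_neq0// (mulrCA r).
set u := (wval j + 1) / (n%:R + 1).
have u0 : 0 <= u by rewrite divr_ge0//; lra.
have u1 : u <= 2^-1 by rewrite /u ler_pdivrMr; lra.
have ru : r * (1 + u) = 1 - u.
  by rewrite /r /u; field; apply/andP; split; apply/lt0r_neq0; lra.
have rge : expR (- (2 * u + 4 * u ^+ 2)) <= r.
  have /expR_le_subr1 : 0 <= u <= 2^-1 by rewrite u0.
  rewrite -ru [leRHS]mulrC ler_pM2l//; lra.
pose m : R := n%:R^-1.
have m0 : 0 < m by rewrite invr_gt0.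
have T'0 : 0 <= T' c by rewrite divr_ge0 ?(ltW s0)// addr_ge0// divr_ge0//; lra.
have T'le : T' (c + 2) <= T' c * expR (16 * m).
  apply: le_trans (_ : T' c * (1 + 16 * m) <= _); last first.
    by rewrite ler_wpM2l// expR_ge1Dx.
  rewrite /T' [leRHS]mulrAC ler_pM2r ?invr_gt0// -/m.
  have : 0 <= c * m * m by rewrite !mulr_ge0//; lra.
  lra.
apply: le_trans (_ : T' c * expR (16 * m) * expR (- T (c + 2) ^+ 2 / 2) <= _).
  by rewrite ler_pM2r ?expR_gt0.
rewrite -[leLHS]mulrA ler_wpM2l// -expRD.
apply: le_trans (_ : expR (- (2 * u + 4 * u ^+ 2)) * expR (- T c ^+ 2 / 2) <= _); last first.
  by rewrite ler_pM2r ?expR_gt0.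
have TE x : T x ^+ 2 = (x + 8 + 4 * x ^+ 2 * m) ^+ 2 * m.
  by rewrite exprMn exprVn ss.
rewrite -expRD ler_expR !TE.
have um : u <= (c + 1) * m.
  apply: (@le_trans _ _ ((wval j + 1) * m)); last by rewrite ler_pM2r//; lra.
  by rewrite /u ler_wpM2l ?lef_pV2 ?posrE; lra.
by apply: exponent_step; rewrite ?(ltW m0)//; lra.
Qed.

End tail_comparison.

(** * Laws determined by lower bounds on their atoms *)

Section discrete_laws.
Context {R : realType} (d : measure_display) (T : measurableType d).
Variables (P : probability T R) (Y : {RV P >-> R}).
Variables (v p : nat -> R) (n : nat).
Hypothesis v_inj : injective v.
Hypothesis pY : forall i, (i <= n)%N -> ((p i)%:E <= P (Y @^-1` [set v i]))%E.

(** The events belonging to distinct values are disjoint, so the lower bounds add up. *)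
Lemma discrete_law_le (A : set R) : measurable A ->
  ((\sum_(i < n.+1) p i * \1_A (v i))%:E <= distribution P Y A)%E.
Proof.
move=> mA.
pose F (i : 'I_n.+1) := if v i \in A then Y @^-1` [set v i] else set0.
have mF i : measurable (F i).
  by rewrite /F; case: ifP => // _; exact: measurable_funPTI.
have tF : trivIset setT F.
  apply/trivIsetP => i j _ _ ij; rewrite -subset0 => t []; rewrite /F.
  case: ifP => // _; case: ifP => // _ /= -> /v_inj /val_inj E.
  by rewrite E eqxx in ij.
have := measure_bigsetU_ord P xpredT mF tF => UE.
apply: (@le_trans _ _ (P (\big[setU/set0]_(i < n.+1) F i))).
  rewrite UE -sumEFin; apply: lee_sum => i _; rewrite /F indicE.
  case: ifP => _; last by rewrite mulr0 measure0.
  by rewrite mulr1; apply: pY; rewrite -ltnS.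
apply: le_measure; rewrite ?inE.
- exact: bigsetU_measurable.
- exact: measurable_funPTI.
rewrite -bigcup_mkord_ord => t [i _]; rewrite /F; case: ifP => // /set_mem + /= ->.
by [].
Qed.

(* The lower bounds leave no mass to spare, neither on A nor on its complement. *)
Lemma discrete_lawE (A : set R) : \sum_(i < n.+1) p i = 1 -> measurable A ->
  distribution P Y A = (\sum_(i < n.+1) p i * \1_A (v i))%:E.
Proof.
move=> p1 mA; apply/eqP; rewrite eq_le discrete_law_le// andbT.
have DC : (distribution P Y (~` A) = 1 - distribution P Y A)%E.
  by rewrite probability_setC.
have := discrete_law_le (measurableC mA); rewrite DC.
have -> : \sum_(i < n.+1) p i * \1_(~` A) (v i) =
    1 - \sum_(i < n.+1) p i * \1_A (v i).
  rewrite -p1 -sumrB; apply: eq_bigr => i _.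
  by rewrite !indicE in_setC; case: (_ \in A) => /=; rewrite ?mulr0 ?mulr1 ?subrr ?subr0.
have [r ->] : exists r, distribution P Y A = r%:E.
  by exists (fine (distribution P Y A)); rewrite fineK// fin_num_measure.
rewrite (_ : 1 - r%:E = (1 - r)%:E)%E// !lee_fin; lra.
Qed.

End discrete_laws.

(** * The law of the walk *)

Section walk_law.
Context {R : realType} (d : measure_display) (T : measurableType d).
Variables (Q : probability T R) (X : nat -> {RV Q >-> R}).
Hypothesis iidX : iid_symmetric_bernoulli X.

Lemma walkS n t : walk X n.+1 t = walk X n t + X n t.
Proof. by rewrite /walk big_ord_recr. Qed.

Lemma walk_0 t : walk X 0 t = 0.
Proof. by rewrite /walk big_ord0. Qed.

Let E (s : nat -> R) (n m : nat) : set T :=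
  \bigcap_(j in [set` iota n m]) X j @^-1` [set s j].

Let mE s n m : measurable (E s n m).
Proof. by apply: fin_bigcap_measurable => // j _; exact: measurable_funPTI. Qed.

Let EP s n m t : E s n m t <-> forall j, (n <= j < n + m)%N -> X j t = s j.
Proof.
split=> [Et j nj|Et j /=]; first by apply: Et; rewrite /= mem_iota.
by rewrite mem_iota => /Et.
Qed.

(** Induction on [n] with [m] later signs prescribed: the last step of the walk is moved into the
    prescribed signs, so independence enters only at [n = 0] and Pascal's rule does the rest. Lower
    bounds suffice for [discrete_lawE]. *)
Lemma walk_cylinder_ge (n m i : nat) (s : nat -> R) :
  (forall j, s j = 1 \/ s j = -1) ->
  ((bpmf n i / 2 ^+ m)%:E <= Q (walk X n @^-1` [set wval n i] `&` E s n m))%E.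
Proof.
elim: n m i s => [|n IH] m i s s1.
  case: i => [|i]; last by rewrite /bpmf bin0n/= !mul0r.
  rewrite (_ : _ `&` _ = E s 0 m); last first.
    rewrite setIidr// => t _ /=.
    by rewrite walk_0 /wval mulr0 subr0.
  have [ind sym] := iidX.
  rewrite /E (ind _ (fun j => [set s j]))//; last exact: iota_uniq.
  rewrite (eq_bigr (fun=> (2^-1)%:E)); last first.
    by move=> j _; case: (s1 j) => ->; have [] := sym j.
  rewrite prodEFin lee_fin big_const_seq iter_mulr_1 count_predT size_iota.
  by rewrite /bpmf bin0 expr0 divr1 mul1r exprVn.
pose s' (b : R) j := if j == n then b else s j.
have s'1 b : b = 1 \/ b = -1 -> forall j, s' b j = 1 \/ s' b j = -1.
  by move=> b1 j; rewrite /s'; case: ifP.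
pose B (b w : R) := walk X n @^-1` [set w] `&` E (s' b) n m.+1.
have mB b w : measurable (B b w) by apply: measurableI => //; exact: measurable_funPTI.
have sub b w t : B b w t -> walk X n.+1 t = w + b /\ E s n.+1 m t.
  move=> [/= wt /EP Et]; split.
    by rewrite walkS wt Et ?/s' ?eqxx// leqnn addnS ltnS leq_addr.
  apply/EP => j /andP[nj jm]; rewrite Et ?/s'; last by rewrite (ltnW nj) addnS -addSn.
  by rewrite gtn_eqF.
have IHm b j : b = 1 \/ b = -1 -> ((bpmf n j / 2 ^+ m.+1)%:E <= Q (B b (wval n j)))%E.
  by move=> b1; apply: IH; exact: s'1.
have wE : wval n i + -1 = wval n.+1 i :> R by rewrite /wval -natr1; ring.
have mL : measurable (walk X n.+1 @^-1` [set wval n.+1 i] `&` E s n.+1 m).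
  by apply: measurableI => //; exact: measurable_funPTI.
case: i => [|i] in wE mL *.
  apply: (@le_trans _ _ (bpmf n 0 / 2 ^+ m.+1)%:E).
    by rewrite lee_fin /bpmf !bin0 !mul1r -!invfM -!exprD addnS addSn.
  apply: (le_trans (IHm (-1) 0%N (or_intror erefl))).
  apply: le_measure; rewrite ?inE// => t /sub[] /= -> ?; split => //=.
have wE' : wval n i + 1 = wval n.+1 i.+1 :> R by rewrite /wval -!natr1; ring.
(* The value is reached by a step up from [wval n i] or down from [wval n i.+1]; the sign of [X n]
   separates the two events. *)
apply: (@le_trans _ _ (Q (B 1 (wval n i) `|` B (-1) (wval n i.+1)))); last first.
  apply: le_measure; rewrite ?inE//; first exact: measurableU.
  by move=> t [/sub[]|/sub[]] /= -> ?; split.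
rewrite measureU//; last first.
  rewrite -subset0 => t [[_ /EP/(_ n)] + [_ /EP/(_ n)]].
  rewrite leqnn addnS ltnS leq_addr /s' eqxx => -> // /(_ isT).
  by move=> /eqP; rewrite -subr_eq0 opprK => /eqP; lra.
have := leeD (IHm 1 i (or_introl erefl)) (IHm (-1) i.+1 (or_intror erefl)).
apply: le_trans; rewrite -EFinD lee_fin /bpmf binS natrD !exprS.
by rewrite [leLHS](_ : _ = ('C(n, i.+1)%:R + 'C(n, i)%:R) / 2 ^+ n / 2 ^+ m / 2);
  [rewrite [leRHS](_ : _ = ('C(n, i.+1)%:R + 'C(n, i)%:R) / 2 ^+ n / 2 ^+ m / 2)//|];
  rewrite !invfM; ring.
Qed.

Lemma walk_pmf_ge n i : ((bpmf n i)%:E <= Q (walk X n @^-1` [set wval n i]))%E.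
Proof.
have := @walk_cylinder_ge n 0 i (fun=> 1); rewrite expr0 divr1 => H.
apply: (le_trans (H _)); first by left.
apply: le_measure; rewrite ?inE; last exact: subIsetl.
  by apply: measurableI => //; exact: measurable_funPTI.
exact: measurable_funPTI.
Qed.

End walk_law.

Lemma wval_inj {R : realType} n : injective (@wval R n).
Proof.
by move=> i j; rewrite /wval => H; apply/eqP; rewrite -(eqr_nat R); apply/eqP; lra.
Qed.

(** Makes the number of thresholds below a point tell which ones they are. *)
Lemma sum_initial_segment (p : pred nat) n : (forall i, p i.+1 -> p i) ->
  let N := (\sum_(i < n) p i)%N in
  (N <= n)%N /\ forall i, (i < n)%N -> p i = (i < N)%N.
Proof.
move=> pS; elim: n => [|n [IHle IH]]; first by rewrite big_ord0.
rewrite big_ord_recr /=; have [pn|pn] := boolP (p n).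
  have pall i : (i <= n)%N -> p i.
    move=> /subnK; move: (n - i)%N => k; elim: k i => [|k IHk] i.
      by rewrite add0n => ->.
    by rewrite addSnnS => /IHk /pS.
  have -> : (\sum_(i < n) p i = n)%N.
    rewrite -[RHS]muln1 -[n in RHS]card_ord -sum_nat_const.
    by apply: eq_bigr => i _; rewrite pall// ltnW.
  by rewrite addn1; split=> // i ilt; rewrite ilt pall.
rewrite addn0; split=> [|i]; first exact: leqW.
rewrite ltnS leq_eqVlt => /predU1P[->|/IH//].
by rewrite (negbTE pn) ltnNge IHle.
Qed.

(** * The quantile coupling and its pointwise error *)

Section quantile_coupling.
Context {R : realType} (n : nat).
Hypothesis n0 : (0 < n)%N.
Let s := Num.sqrt (n%:R : R).

(** Quantile thresholds: the step function passes from [wval n i.-1] to [wval n i] at [a i]. *)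
Variable a : nat -> R.
Hypothesis aE : forall i, (0 < i <= n)%N -> gtail (a i) = btail n i.

Let s0 : 0 < s. Proof. by rewrite sqrtr_gt0 ltr0n. Qed.
Let ss : s ^+ 2 = n%:R. Proof. by rewrite sqr_sqrtr// ler0n. Qed.
Let n1 : 1 <= n%:R :> R. Proof. by rewrite ler1n. Qed.

Lemma threshold_nondecr i j : (0 < i)%N -> (i <= j)%N -> (j <= n)%N -> a i <= a j.
Proof.
move=> i0 ij jn; rewrite -gtail_le_mono !aE ?btail_nincr//.
  by rewrite i0 (leq_trans ij).
by rewrite (leq_trans i0 ij).
Qed.

Lemma threshold_rev i : (0 < i <= n)%N -> a (n.+1 - i) = - a i.
Proof.
move=> i_n; have E : gtail (a (n.+1 - i)) = gtail (- a i).
  by rewrite gtailN !aE ?btail_rev//; lia.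
by apply/eqP; rewrite eq_le -!(gtail_le_mono (a _)) -!(gtail_le_mono (- _)) E lexx.
Qed.

Lemma threshold_ge i : (n < i.*2)%N -> (i <= n)%N -> wval n i - 3 <= s * a i.
Proof.
move=> ni ile; have := @btail_le_gtail R n n0 i ni (leqW ile).
by rewrite -aE ?gtail_le_mono ?ler_pdivrMr 1?mulrC//; lia.
Qed.

Lemma threshold_le i : (n <= i.*2)%N -> (0 < i <= n)%N ->
  s * a i <= wval n i + 8 + 4 * wval n i ^+ 2 / n%:R.
Proof.
move=> ni i_n; have := @gtail_le_btail R n n0 i ni ltac:(lia).
by rewrite -aE// gtail_le_mono ler_pdivlMr 1?mulrC.
Qed.

(* At [i = n] no threshold bounds [z] from above; there [s <= z + 3] makes
   [s * z] quadratic in [z]. *)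
Lemma quantile_dist_half i z : (n <= i.*2)%N -> (i <= n)%N ->
  ((0 < i)%N -> a i <= z) -> ((i < n)%N -> z <= a i.+1) ->
  `|wval n i - s * z| <= 210 + 8 * z ^+ 2.
Proof.
move=> ni ile az za.
have i0 : (0 < i)%N by lia.
have {}az : s * a i <= s * z by rewrite ler_pM2l// az.
have s1 : 1 <= s by rewrite -sqrtr1 ler_sqrt// ltr0n.
have w0 : 0 <= wval n i :> R.
  have : (n%:R <= (i.*2)%:R :> R) by rewrite ler_nat.
  rewrite /wval -muln2 natrM; lra.
have up : (i < n)%N -> s * z <= wval n i + 10 + 4 * (wval n i + 2) ^+ 2 / n%:R.
  move=> iltn; have := @threshold_le i.+1 ltac:(lia) ltac:(lia).
  rewrite wvalS; have : s * z <= s * a i.+1 by rewrite ler_pM2l// za.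
  lra.
have le_divn (x : R) : 0 <= x -> x / n%:R <= x.
  by move=> x0; rewrite ler_pdivrMr ?ltr0n// ler_peMr.
have z2 : 0 <= z ^+ 2 by exact: sqr_ge0.
(* If [n = i.*2] the walk is at 0, outside the range of [threshold_ge]; the lower bound comes from
   [a i = - a i.+1]. *)
have [ni2|] := ltnP n i.*2; last first.
  move=> ni2; have {ni2}ni2 : (n = i.*2)%N by lia.
  have iltn : (i < n)%N by lia.
  have w00 : wval n i = 0 :> R by rewrite /wval ni2 -muln2 natrM; ring.
  have sz := up iltn.
  have a1 := @threshold_le i.+1 ltac:(lia) ltac:(lia).
  have aN := @threshold_rev i ltac:(lia).
  rewrite (_ : (n.+1 - i = i.+1)%N) in aN; last by lia.
  rewrite aN wvalS w00 in a1.
  rewrite w00 in sz *.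
  have := @le_divn 16 ltac:(lra).
  move: a1 sz; rewrite ler_norml !add0r !expr2 => a1 sz h.
  by apply/andP; split; lra.
have lo := threshold_ge ni2 ile.
rewrite ler_norml; apply/andP; split; last lra.
have [iltn|] := ltnP i n.
  have sz := up iltn.
  (* From [wval n i + 2 <= s * z + 5] and (x + 5)^2 <= 2 x^2 + 50. The final constants arise here as
     4 (2 z^2 + 50) + 10. *)
  have w5 : (wval n i + 2) ^+ 2 <= 2 * (z ^+ 2 * n%:R) + 50.
    apply: le_trans (_ : (s * z + 5) ^+ 2 <= _).
      by rewrite ler_sqr ?nnegrE; lra.
    have : (s * z) ^+ 2 = z ^+ 2 * n%:R by rewrite exprMn ss mulrC.
    have : 0 <= (s * z - 5) ^+ 2 by exact: sqr_ge0.
    rewrite -ss !expr2; lra.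
  have : (wval n i + 2) ^+ 2 / n%:R <= 2 * z ^+ 2 + 50.
    rewrite ler_pdivrMr ?ltr0n// mulrDl -mulrA.
    apply: (le_trans w5); rewrite lerD2l ler_peMr//.
  lra.
move=> nlei; have wn : wval n i = n%:R :> R.
  have -> : i = n by lia.
  by rewrite /wval; ring.
rewrite wn -ss in lo az *.
have [z0|z0] := leP z 0.
  have : s * z <= 0 by rewrite pmulr_rle0.
  have : 0 <= s ^+ 2 by exact: sqr_ge0.
  lra.
have sz3 : s <= z + 3.
  (* [lo] and [az] give [s * (s - z) <= 3], while [1 <= s]. *)
  rewrite leNgt; apply/negP => zs.
  have : 1 * 3 < s * (s - z) by rewrite ltr_pM//; lra.
  by rewrite expr2 in lo az; lra.
have : s * z <= (z + 3) * z by rewrite ler_pM2r.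
have : 0 <= (z - 1) ^+ 2 by exact: sqr_ge0.
have : 0 <= s ^+ 2 by exact: sqr_ge0.
rewrite !expr2; lra.
Qed.

(** Reflecting [i] to [n - i] and [z] to [- z] exchanges the two threshold conditions, by
    [threshold_rev]. *)
Lemma quantile_dist i z : (i <= n)%N ->
  ((0 < i)%N -> a i <= z) -> ((i < n)%N -> z <= a i.+1) ->
  `|wval n i - s * z| <= 210 + 8 * z ^+ 2.
Proof.
move=> ile az za; have [ni|ni] := leqP n i.*2; first exact: quantile_dist_half.
have := @quantile_dist_half (n - i)%N (- z).
rewrite (_ : wval n (n - i) = - wval n i :> R); last first.
  by rewrite /wval natrB//; ring.
rewrite mulrN opprK -normrN opprD opprK sqrrN; apply.
- lia.
- exact: leq_subr.
- move=> _; rewrite (_ : (n - i = n.+1 - i.+1)%N); last lia.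
  by rewrite threshold_rev ?lerN2 ?za//; lia.
- move=> i0; rewrite (_ : ((n - i).+1 = n.+1 - i)%N); last lia.
  by rewrite threshold_rev ?lerN2 ?az//; lia.
Qed.

(** The quantile transform, written with indicators so that measurability is immediate. *)
Definition qwalk (z : R) : R := 2 * \sum_(i < n) \1_`]a i.+1, +oo[ z - n%:R.

Lemma measurable_qwalk : measurable_fun [set: R] qwalk.
Proof.
apply: measurable_funB => //; apply: measurable_funM => //.
by apply: measurable_sum => i; exact: measurable_indic.
Qed.

(* [minn] keeps the index in the range where [a] is known to be monotone. *)
Let N z := (\sum_(i < n) (a (minn i.+1 n) < z)%R)%N.

Let NP z : (N z <= n)%N /\ forall i, (i < n)%N -> (a i.+1 < z) = (i < N z)%N.
Proof.
have [|le H] := @sum_initial_segment (fun i => a (minn i.+1 n) < z) n.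
  by move=> i; apply: le_lt_trans; apply: threshold_nondecr; lia.
by split=> // i iltn; rewrite -H// (minn_idPl _).
Qed.

Lemma qwalkE z : qwalk z = wval n (N z).
Proof.
rewrite /qwalk /wval natr_sum; congr (2 * _ - _); apply: eq_bigr => i _.
by rewrite indicE mem_setE in_itv/= andbT (minn_idPl _)//.
Qed.

Lemma qwalk_dist z : `|qwalk z - z * s| <= 210 + 8 * z ^+ 2.
Proof.
rewrite qwalkE mulrC; have [le H] := NP z; apply: quantile_dist => //.
  by move=> N0; rewrite -(prednK N0) ltW// H; lia.
by move=> Nn; rewrite leNgt H// ltnn.
Qed.

(** The event is [A i] minus [A i.+1], where [A j] says that at least [j] thresholds are passed; by
    the choice of [a] its Gaussian mass is [btail n j]. *)
Lemma qwalk_pmf i : (i <= n)%N ->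
  normal_prob 0 1 (qwalk @^-1` [set wval n i]) = (bpmf n i)%:E.
Proof.
move=> ile; pose A j := [set z | (j <= N z)%N].
have AE j : (j < n)%N -> A j.+1 = `]a j.+1, +oo[%classic.
  move=> jn; apply/seteqP; split=> z /=; rewrite in_itv/= andbT.
    by rewrite (NP z).2.
  by rewrite (NP z).2.
have A0 : A 0%N = setT by apply/seteqP; split.
have An : A n.+1 = set0.
  by rewrite -subset0 => z; rewrite /A/= ltnNge (NP z).1.
have mA j : (j <= n.+1)%N -> measurable (A j).
  case: j => [|j]; first by rewrite A0.
  by rewrite ltnS leq_eqVlt => /predU1P[->|/AE->//]; rewrite An.
have PA j : (j <= n.+1)%N -> normal_prob 0 1 (A j) = (btail n j)%:E.
  case: j => [|j]; first by rewrite A0 probability_setT btail0.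
  rewrite ltnS leq_eqVlt => /predU1P[->|jn]; first by rewrite An measure0 btail_gt.
  by rewrite AE// normal_prob_gtail aE.
rewrite (_ : _ @^-1` _ = A i `\` A i.+1); last first.
  apply/seteqP; split=> z; rewrite /A/= qwalkE.
    by move=> /wval_inj ->; split=> //; rewrite ltnn.
  by move=> [iN /negP]; rewrite -leqNgt => Ni; congr wval; lia.
have -> : (normal_prob 0 1 (A i `\` A i.+1) =
    normal_prob 0 1 (A i) - normal_prob 0 1 (A i `&` A i.+1))%E.
  apply: measureD; [exact: mA (leqW ile)|exact: (mA i.+1)|].
  by rewrite -ge0_fin_numE// fin_num_measure//; exact: mA (leqW ile).
rewrite setIidr; last by move=> z; exact: ltnW.
by rewrite (PA i (leqW ile)) (PA i.+1)// -EFinB (btailE ile) addrK.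
Qed.

End quantile_coupling.

(** * Exponential moment of the coupling error *)

Theorem lemma2 (R : realType) :
  exists theta0 kappa0 : R, 0 < theta0 /\
    forall (d : measure_display) (Omega : measurableType d)
      (Q : probability Omega R) (X : nat -> {RV Q >-> R}),
      iid_symmetric_bernoulli X ->
      forall n : nat, (1 <= n)%N ->
        exists (d' : measure_display) (T : measurableType d')
          (P : probability T R) (S Z : {RV P >-> R}),
          coupling (distribution Q (walk X n)) (normal_prob 0 1) S Z /\
          ('E_P[(fun t => expR (theta0 * `|S t - Z t * Num.sqrt n%:R|))%R]
             <= kappa0%:E)%E.
Proof.
(* Since 8 * 3 / 64 = 3 / 8, the bound 210 + 8 z^2 leads to the Gaussian moment equal to 2. *)
exists (3 / 64), (expR (3 / 64 * 210) * 2); split; first lra.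
move=> d Omega Q X iidX n n0.
have /boolp.choice[a aE] : forall i, exists x : R,
    (0 < i <= n)%N -> gtail x = btail n i.
  (* Only for these [i] is the tail known to lie strictly between 0 and 1; elsewhere 0 is a
     placeholder. *)
  move=> i; have [i_n|/negP i_n] := boolP (0 < i <= n)%N; last by exists 0.
  have [i0 ile] := andP i_n.
  have [|x xE] := @gtail_surj R (btail n i); last by exists x.
  by rewrite btail_gt0// btail_lt1.
pose P : probability (measurableTypeR R) R := normal_prob 0 1.
have mS : @measurable_fun _ _ (measurableTypeR R) R setT (qwalk n a).
  exact: measurable_qwalk.
have mZ : @measurable_fun _ _ (measurableTypeR R) R setT id by exact: measurable_id.
pose S : {RV P >-> R} := @mfun_Sub _ _ (measurableTypeR R) R _ (mem_set mS).
pose Z : {RV P >-> R} := @mfun_Sub _ _ (measurableTypeR R) R _ (mem_set mZ).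
exists _, _, P, S, Z; split; first split.
- move=> A mA.
  (* Both laws dominate the masses [bpmf n i], whose total 1 forces equality. *)
  have p1 : \sum_(i < n.+1) bpmf n i = 1 :> R.
    by rewrite -(btail0 n) /btail big_mkord.
  rewrite (discrete_lawE (@wval_inj R n) (fun i _ => walk_pmf_ge iidX n i) p1 mA).
  apply: (discrete_lawE (@wval_inj R n)) => // i ile.
  by rewrite -(qwalk_pmf n0 aE ile).
- by move=> A mA.
rewrite unlock.
apply: (@le_trans _ _ (\int[P]_z
    ((expR (3 / 64 * 210))%:E * (expR (3 / 8 * z ^+ 2))%:E))%E).
  apply: ge0_le_integral => //=.
  - apply/measurable_EFinP/measurableT_comp => //; apply: measurable_funM => //.
    by apply: measurableT_comp => //; apply: measurable_funB => //; exact: measurable_funM.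
  - apply/measurable_EFinP/measurable_funM => //.
    apply: measurableT_comp => //; exact: measurable_funM.
  - move=> z _; rewrite -EFinM lee_fin -expRD ler_expR.
    have := qwalk_dist n0 aE z; lra.
rewrite ge0_integralZl//=; first by rewrite normal_expR_sqr -EFinM.
by apply/measurable_EFinP; apply: measurableT_comp => //; exact: measurable_funM.
Qed.
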